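(* Let $q\ge 2$ be an integer and let $A_q=\{q^i:i\in\mathbb{N}\}$. Then for all positive integers $m,n$ we have $P(m,n,A_q)\le F(2n-1)$.
   Context: $\mathbb{N}$ denotes the non-negative integers, so $A_q=\{1,q,q^2,\ldots\}$. For a set $A$ of positive integers and positive integers $m,n$, $P(m,n,A)$ denotes the number of partitions of $m$ into at most $n$ parts from $A$, i.e. the number of ways to write $m=\alpha_1+\alpha_2+\cdots+\alpha_t$ with $t\le n$, $\alpha_1\le\alpha_2\le\cdots\le\alpha_t$, and all $\alpha_i\in A$ (not necessarily distinct). Equivalently, writing $A=\{a_1<a_2<\cdots\}$, it is the number of sequences $(x_i)$ of non-negative integers with $\sum_i x_ia_i=m$ and $\sum_i x_i\le n$. $F(n)$ is the $n$-th Fibonacci number: $F(1)=F(2)=1$, $F(n)=F(n-1)+F(n-2)$ for $n\ge 3$, and $F(i)=0$ for all integers $i\le 0$. *)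

(* Defs.v *)
From mathcomp Require Import all_boot.
From mathcomp Require Import classical_sets.

Set Implicit Arguments.
Unset Strict Implicit.
Unset Printing Implicit Defensive.

(* A partition is its nondecreasing sequence of parts.  Bounding the parts by
   m only serves to make the type finite: a part never exceeds the sum.
   [A] is meant to consist of positive integers. *)
Definition is_partition_of (m : nat) (A : set nat) (s : seq nat) : bool :=
  [&& sorted leq s, all (fun a => a \in A) s & sumn s == m].

Definition P (m n : nat) (A : set nat) : nat :=
  #|[pred s : n.-bseq 'I_m.+1 | is_partition_of m A (map val s)]|.

Definition powers (q : nat) : set nat := range (fun i : nat => q ^ i).

(* Only nonnegative indices are represented; the convention F(i) = 0 for
   i <= 0 survives as fib 0 = 0. *)
Fixpoint fib (n : nat) : nat :=
  match n with
  | 0 => 0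
  | p.+1 => if p is r.+1 then fib p + fib r else 1
  end.

(* Main.v *)
Require Import Defs.
From mathcomp Require Import all_boot.
From mathcomp Require Import classical_sets.
From mathcomp Require Import zify.

(** Read [m] from its most significant base-[q] digit downwards.  Suppose the
    parts larger than [q ^ i] have been chosen and that [m] is still to be
    written with at most [n] parts among [1, q, ..., q ^ i].  The remainder holds
    [c = m %/ q ^ i] units of size [q ^ i].  If [x] of them are kept as parts, the
    other [y = c - x] are split, each into [q] units of size [q ^ i.-1], so that
    at least [q * y] units are found one level below.

    Units never disappear, so the relevant budget is the excess [e = n - c] of
    allowed parts over units already present.  Splitting [y] units creates at
    least [y] additional ones and lowers the excess to at most [e - y].  Hence
    if [K e] bounds the count for excess [e] and [c > 0], it is enough that
    [K e >= K0 e + K (e - 1) + ... + K 0], where [K0 e] bounds the count once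
    no unit is left ([y = 0]).  In that case nothing happens until a nonzero
    digit of [m] shows up and lowers the excess by at least one, so
    [K0 e = K (e - 1)] for [e > 0], and [K0 0 = 1].  The solution of this
    recurrence is [K e = fib (2 e + 1)], since
    [fib 1 + fib 3 + ... + fib (2 e - 1) = fib (2 e)].

    Starting from a power [q ^ i > m], there is no unit and the excess is [n],
    which gives [K0 n = K (n - 1) = fib (2 n - 1)].  The bound is propagated in
    [size_power_partitions], its numerical content is [unit_bound_rec], and
    [mem_power_partitions] says that the top-down choices reach every
    partition. *)

(** * Fibonacci numbers *)

Lemma fibSS n : fib n.+2 = fib n.+1 + fib n.
Proof. by []. Qed.

Lemma fib_gt0 n : 0 < fib n.+1.
Proof. by elim: n => // n IHn; rewrite fibSS addn_gt0 IHn. Qed.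

Lemma leq_fib : {homo fib : m n / m <= n}.
Proof.
apply: homo_leq => // [x y z|n]; first exact: leq_trans.
by case: n => // n; rewrite fibSS leq_addr.
Qed.

(** The form in which the sum of the odd-indexed Fibonacci numbers is needed:
    the number [c] of units available for splitting may truncate it. *)
Lemma sum_odd_fib c e :
  \sum_(y < c) (y < e) * fib (e - y.+1).*2.+1 <= fib e.*2.
Proof.
elim: c e => [|c IHc] [|e]; rewrite ?big_ord0 //.
  by rewrite big1.
rewrite big_ord_recl ltn0Sn mul1n subSS subn0 doubleS fibSS leq_add2l.
by apply: leq_trans (IHc e); apply: leq_sum => i _; rewrite ltnS subSS.
Qed.

(** * The bound for a given number of units *)

(** [maxn 1 c] covers two cases at once: [c] units use up [c] of the [n] parts,
    and no unit at all still means one part reserved for the next nonzero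
    digit. When [n = 0 = c] the truncated subtraction gives [fib 1 = 1], which
    counts the empty partition. *)
Definition unit_bound c n := (c <= n) * fib (n - maxn 1 c).*2.+1.

(** Lets the induction forget the next digit of [m] and replace [q] by 2: both
    only add units. *)
Lemma leq_unit_bound c d n : c <= d -> unit_bound d n <= unit_bound c n.
Proof.
move=> le_cd; rewrite /unit_bound; case: (leqP d n) => // le_dn.
rewrite (leq_trans le_cd le_dn) !mul1n; apply: leq_fib.
by rewrite ltnS leq_double leq_sub2l //; lia.
Qed.

(** The recurrence that determines the bound, in its worst case: two is the least
    number of units that splitting one can create, and the next digit is 0. *)
Lemma unit_bound_rec c n :
  \sum_(x < (minn n c).+1) unit_bound (2 * (c - x)) (n - x) <= unit_bound c n.
Proof.
have [lt_nc|le_cn] := ltnP n c.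
  (* More units than parts: whatever is kept, the [c - x] split units already
     outnumber the [n - x] parts that remain. *)
  rewrite big1 // => x _; rewrite /unit_bound.
  by have -> : (2 * (c - x) <= n - x) = false; first by have := ltn_ord x; lia.
have [e ->] : exists e, n = c + e.
  by exists (n - c); lia.
(* Re-indexing by the number [y] of split units. *)
rewrite (reindex_inj rev_ord_inj) /= big_ord_recl.
rewrite subSS subn0 subnn muln0 addKn.
case: c {le_cn} => [|c]; first by rewrite big_ord0 addn0.
have -> : unit_bound c.+1 (c.+1 + e) = fib e.*2.+1.
  by rewrite /unit_bound leq_addr mul1n (maxn_idPr _) // addKn.
have step : unit_bound 0 e + fib e.*2 <= fib e.*2.+1.
  by case: e => // e; rewrite doubleS fibSS /unit_bound mul1n subn1 addnC.
apply: leq_trans step; rewrite leq_add2l; apply: leq_trans (sum_odd_fib c.+1 e).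
apply: leq_sum => y _; rewrite /unit_bound.
have lt_yc := ltn_ord y; rewrite lift0.
have -> : c.+1 - (c.+2 - y.+2) = y.+1 by lia.
have -> : c.+1 + e - (c.+2 - y.+2) = e + y.+1 by lia.
have -> : (2 * y.+1 <= e + y.+1) = (y < e) by lia.
by have -> : e + y.+1 - maxn 1 (2 * y.+1) = e - y.+1 by lia.
Qed.

(** * Enumerating the partitions from the largest power down *)

(** Partitions of [m] into at most [n] parts among [1, q, ..., q ^ i]; [x] is the
    multiplicity of the largest of these powers. *)
Fixpoint power_partitions q i m n : seq (seq nat) :=
  if i is j.+1 then
    [seq s ++ nseq x (q ^ i) | x <- iota 0 (minn n (m %/ q ^ i)).+1,
                               s <- power_partitions q j (m - x * q ^ i) (n - x)]
  else if m <= n then [:: nseq m 1] else [::].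

Lemma power_partitionsS q i m n :
  power_partitions q i.+1 m n =
  [seq s ++ nseq x (q ^ i.+1) |
     x <- iota 0 (minn n (m %/ q ^ i.+1)).+1,
     s <- power_partitions q i (m - x * q ^ i.+1) (n - x)].
Proof. by []. Qed.

Lemma size_power_partitions q i m n : 1 < q ->
  size (power_partitions q i m n) <= unit_bound (m %/ q ^ i) n.
Proof.
move=> q_gt1; elim: i m n => [|i IHi] m n.
  by rewrite /= divn1 /unit_bound; case: (m <= n); rewrite // mul1n fib_gt0.
rewrite power_partitionsS size_allpairs_dep.
apply: leq_trans (unit_bound_rec (m %/ q ^ i.+1) n).
rewrite sumnE big_map -[iota _ _]/(index_iota 0 _.+1) big_mkord.
apply: leq_sum => -[x _] _ /=; apply: leq_trans (IHi _ _) _; apply: leq_unit_bound.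
(* Each of the [m %/ q ^ i.+1 - x] split units gives [q >= 2] smaller ones. *)
have q_pos : 0 < q ^ i by rewrite expn_gt0 (ltnW q_gt1).
rewrite leq_divRL // (leq_trans _ (leq_sub2r _ (leq_divM m (q ^ i.+1)))) //.
by rewrite -mulnBl mulnAC [leqLHS]mulnC leq_mul2l expnS leq_mul2r q_gt1 !orbT.
Qed.

(** Equality of lists, not up to permutation: sortedness makes the copies of the
    largest part a suffix, which is where [power_partitions] puts them. *)
Lemma sorted_split_max Q s : sorted leq s -> all (leq^~ Q) s ->
  s = [seq a <- s | a < Q] ++ nseq (count_mem Q s) Q.
Proof.
elim: s => // a s IHs /= path_as /andP[le_aQ le_sQ].
have /IHs/(_ le_sQ) eq_s := path_sorted path_as.
have [eq_aQ|ne_aQ] := eqVneq a Q; last by rewrite ltn_neqAle ne_aQ le_aQ /= -eq_s.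
rewrite eq_aQ ltnn; suff /eqP eq0 : [seq b <- s | b < Q] == [::].
  by rewrite eq0 /= add0n {1}eq_s eq0.
rewrite -size_eq0 size_filter -leqn0 leqNgt -has_count -all_predC.
apply: sub_all (order_path_min leq_trans path_as) => b /= le_ab.
by rewrite -leqNgt -eq_aQ.
Qed.

Lemma mem_power_partitions q i m n s : 1 < q ->
  sorted leq s -> {in s, forall a, exists2 j, j <= i & a = q ^ j} ->
  sumn s = m -> size s <= n -> s \in power_partitions q i m n.
Proof.
move=> q_gt1; elim: i m n s => [|i IHi] m n s s_sorted s_pow s_sum s_size.
  have s_ones : s = nseq (size s) 1.
    apply/all_pred1P/allP => a /s_pow[j].
    by rewrite leqn0 => /eqP-> ->.
  have size_m : size s = m by rewrite -s_sum {2}s_ones sumn_nseq mul1n.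
  by rewrite /= -size_m s_size inE -s_ones.
set Q := q ^ i.+1; pose r := [seq a <- s | a < Q]; pose x := count_mem Q s.
have eq_s : s = r ++ nseq x Q.
  apply: sorted_split_max => //; apply/allP => a /s_pow[j le_ji ->].
  by rewrite leq_exp2l.
have eq_m : m = sumn r + x * Q by rewrite -s_sum {1}eq_s sumn_cat sumn_nseq mulnC.
have eq_size : size s = size r + x by rewrite {1}eq_s size_cat size_nseq.
rewrite power_partitionsS -/Q; apply/allpairsPdep; exists x, r.
split=> //.
  rewrite mem_iota /= add0n ltnS leq_min leq_divRL ?expn_gt0 ?(ltnW q_gt1) //.
  by rewrite eq_m leq_addl andbT; lia.
apply: IHi; [exact: (sorted_filter leq_trans) | | by lia | by lia].
move=> a; rewrite mem_filter => /andP[lt_aQ /s_pow[j _ eq_a]].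
by exists j; rewrite // -ltnS -(ltn_exp2l _ _ q_gt1) -eq_a.
Qed.

Lemma P_powers_le_size q m n : 1 < q ->
  P m n (powers q) <= size (power_partitions q m m n).
Proof.
move=> q_gt1; rewrite /P cardE.
pose vals (s : n.-bseq 'I_m.+1) : seq nat := map val s.
have vals_inj : injective vals by move=> s t /(inj_map val_inj)/val_inj.
rewrite -(size_map vals) uniq_leq_size ?(map_inj_uniq vals_inj) ?enum_uniq //.
move=> _ /mapP[s s_part ->]; move: s_part; rewrite mem_enum inE.
case/and3P=> s_sorted /allP s_pow /eqP s_sum.
apply: mem_power_partitions => //; last by rewrite size_map size_bseq.
move=> a s_a; have := s_pow a s_a; rewrite in_setE => -[j _ eq_a]; exists j => //.
(* A part is at most [m], and [m < q ^ m]. *)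
rewrite ltnW // -(ltn_exp2l _ _ q_gt1) eq_a.
apply: leq_ltn_trans (ltn_expl m q_gt1).
by case/mapP: s_a => b _ ->; rewrite -ltnS ltn_ord.
Qed.

Theorem corollary2p6 (q : nat) (hq : 2 <= q) (m n : nat)
    (hm : 0 < m) (hn : 0 < n) :
  P m n (powers q) <= fib (2 * n - 1).
Proof.
apply: leq_trans (P_powers_le_size q m n hq) _.
apply: leq_trans (size_power_partitions q m m n hq) _.
rewrite (divn_small (ltn_expl m hq)) /unit_bound leq0n mul1n.
have -> : 2 * n - 1 = (n - maxn 1 0).*2.+1 by lia.
exact: leqnn.
Qed.
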